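(* Let $T$ be a tree that contains a subgraph isomorphic to $T_{3,3}$. Then $\mathrm{lcapt}(T) \leq \left\lfloor \frac{\ell(T)}{2} \right\rfloor - 1$, where $\ell(T)$ is the number of leaves of $T$.
   Context: $T_{3,3}$ is the rooted tree of depth 2 whose root has exactly three children, each of which has exactly two children (leaves); it has 10 vertices. The localization game on a connected graph $G$ with $k$ cops: the robber first chooses a starting vertex (invisible to the cops; the robber knows the cops' strategy). Then rounds are played; in each round the cops choose (probe) any $k$ vertices $c_1,\dots,c_k$ of $G$ and learn $(d(c_1,r),\dots,d(c_k,r))$, where $r$ is the robber's current vertex; then the robber moves to a neighbor or stays put. The cops win if after finitely many rounds they can determine the robber's exact position. The localization number $\zeta(G)$ is the minimum $k$ for which the cops have a winning strategy. For $k \geq \zeta(G)$, $\mathrm{lcapt}_k(G)$ is the number of rounds (probes) needed for $k$ cops to determine the robber's location under optimal play (cops minimizing, robber maximizing), and $\mathrm{lcapt}(G) = \mathrm{lcapt}_{\zeta(G)}(G)$. (A tree containing $T_{3,3}$ has $\zeta(T)=2$.) *)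

(* Defs.v *)
From mathcomp Require Import all_boot.
From mathcomp Require Import boolp.

Set Implicit Arguments.
Unset Strict Implicit.
Unset Printing Implicit Defensive.

Record sgraph := SGraph {
  vertex :> finType;
  adj : rel vertex;
  adj_sym : symmetric adj;
  adj_irr : irreflexive adj }.

Section Graphs.
Variable G : sgraph.

Definition connected : Prop :=
  0 < #|G| /\ forall x y : G, connect (@adj G) x y.

(* [ucycle] also accepts the walk x, y, x along a single edge, hence the
   bound: a cycle of a simple graph has at least three vertices. *)
Definition acyclic : Prop :=
  forall c : seq G, ucycle (@adj G) c -> size c < 3.

Definition is_tree : Prop := connected /\ acyclic.

Definition degree (x : G) : nat := #|[set y | adj x y]|.

Definition leaves : {set G} := [set x | degree x == 1].

Definition walk_of_length (n : nat) (x y : G) : bool :=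
  [exists p : n.-tuple G, path (@adj G) x p && (last x p == y)].

(* The least length of a walk from x to y; it is at most #|G| - 1 when y is
   reachable from x, and [find] returns #|G| otherwise. *)
Definition dist (x y : G) : nat :=
  find (fun n => walk_of_length n x y) (iota 0 #|G|).

End Graphs.

Definition contains_copy (G H : sgraph) : Prop :=
  exists2 f : H -> G, injective f & forall u v : H, adj u v -> adj (f u) (f v).

(* T_{3,3}: [None] is the root, [Some (i, None)] its i-th child, and
   [Some (i, Some j)] the j-th child of the latter. *)
Definition T33_vertex : finType := option ('I_3 * option 'I_2).

Definition T33_parent (u v : T33_vertex) : bool :=
  match u, v with
  | None, Some (_, None) => true
  | Some (i, None), Some (j, Some _) => i == j
  | _, _ => false
  end.

Definition T33_adj : rel T33_vertex :=
  fun u v => T33_parent u v || T33_parent v u.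

Lemma T33_adj_sym : symmetric T33_adj.
Proof. by move=> u v; rewrite /T33_adj orbC. Qed.

Lemma T33_adj_irr : irreflexive T33_adj.
Proof. by case=> [[i [j|]]|]. Qed.

Definition T33 : sgraph := SGraph T33_adj_sym T33_adj_irr.

Section LocalizationGame.
Variable G : sgraph.

(* The next probe, as a function of the answers to all earlier probes. *)
Definition strategy (k : nat) := seq (k.-tuple nat) -> k.-tuple G.

(* r t is the position of the robber when the probe number t (counted from 0)
   is made. *)
Definition robber_walk (r : nat -> G) : Prop :=
  forall t, r t.+1 = r t \/ adj (r t) (r t.+1).

Fixpoint answers k (s : strategy k) (r : nat -> G) (t : nat) :
    seq (k.-tuple nat) :=
  if t is t'.+1 then
    let h := answers s r t' in
    rcons h [tuple of [seq dist c (r t') | c <- s h]]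
  else [::].

(* After the answer to probe number t, i.e. after t.+1 rounds, every robber
   compatible with the answers received so far stands on r t. *)
Definition located k (s : strategy k) (r : nat -> G) (t : nat) : Prop :=
  forall r' : nat -> G, robber_walk r' ->
    answers s r' t.+1 = answers s r t.+1 -> r' t = r t.

Definition winning_strategy k (s : strategy k) : Prop :=
  forall r, robber_walk r -> exists t, located s r t.

Definition cops_win (k : nat) : Prop := exists s : strategy k, winning_strategy s.

Definition wins_within k (s : strategy k) (m : nat) : Prop :=
  forall r, robber_walk r -> exists2 t, t < m & located s r t.

Definition cops_win_within (k m : nat) : Prop :=
  exists s : strategy k, wins_within s m.

Lemma dist_eq0 (x y : G) : dist x y = 0 -> x = y.
Proof.
have : 0 < #|G| by apply/card_gt0P; exists x.
rewrite /dist; case: #|G| => // n _ /=.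
case: ifP => // /existsP[p]; rewrite tuple0 /= => /eqP xy _.
exact: xy.
Qed.

Lemma distxx (x : G) : dist x x = 0.
Proof.
have : 0 < #|G| by apply/card_gt0P; exists x.
rewrite /dist; case: #|G| => // n _ /=.
suff -> : walk_of_length 0 x x by [].
by apply/existsP; exists [tuple]; rewrite /= eqxx.
Qed.

Lemma ex_cops_win : exists k, `[< cops_win k >].
Proof.
exists #|G|; apply/asboolP; exists (fun=> enum_tuple G) => r rr.
exists 0 => r' _ /= [] /(congr1 (fun s => nth 0 s (index (r 0) (enum G)))).
have re : r 0 \in enum G by rewrite mem_enum.
have ri : index (r 0) (enum G) < size (enum G) by rewrite index_mem.
move: (enum G) re ri => /= E re ri.
rewrite !(nth_map (r 0)) // nth_index // distxx.
by move/dist_eq0 => ->.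
Qed.

Definition localization_number : nat := ex_minn ex_cops_win.

Lemma localization_numberP : cops_win localization_number.
Proof. by rewrite /localization_number; case: ex_minnP => k /asboolP. Qed.

Lemma eq_answers k (s : strategy k) (r r' : nat -> G) t :
  (forall i, i < t -> r i = r' i) -> answers s r t = answers s r' t.
Proof.
elim: t => //= t IH rr'; rewrite IH => [|i it]; first by rewrite rr'.
exact/rr'/ltnW.
Qed.

Lemma eq_located k (s : strategy k) (r r' : nat -> G) t :
  (forall i, i <= t -> r i = r' i) -> located s r t -> located s r' t.
Proof.
move=> rr' loc q qw; rewrite -(rr' t) // -(@eq_answers _ s r r' t.+1) //.
exact: loc.
Qed.

(* The duration of a winning strategy is bounded, by compactness of the set of
   robber walks (Koenig's lemma). *)
Lemma winning_strategy_within k (s : strategy k) :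
  winning_strategy s -> exists m, wins_within s m.
Proof.
move=> win; apply: contrapT => /forallNP nwin.
pose good (n : nat) (q : nat -> G) := forall m, exists r,
  [/\ robber_walk r, forall i, i < n -> r i = q i &
      forall t, t < m -> ~ located s r t].
have good_ext n q : good n q ->
    exists q', good n.+1 q' /\ forall i, i < n -> q' i = q i.
  move=> gq; apply: contrapT => /forallNP bad.
  have /choice[M hM] : forall x : G, exists m, forall r, robber_walk r ->
      (forall i, i < n -> r i = q i) -> r n = x ->
      exists2 t, t < m & located s r t.
    move=> x; pose q' i := if i < n then q i else x.
    have := bad q' => /not_andP[|]; last by case; move=> i; rewrite /q' => ->.
    move=> /existsNP[m hm]; exists m => r rw rq rn.
    apply: contrapT => nloc; apply: hm; exists r; split=> //.
      move=> i; rewrite ltnS leq_eqVlt => /orP[/eqP ->|lt]; rewrite /q'.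
        by rewrite ltnn.
      by rewrite lt rq.
    by move=> t tm lt; apply: nloc; exists t.
  have [r [rw rq nloc]] := gq (\max_x M x).
  have [t tM loc] := hM (r n) r rw rq erefl.
  by apply: nloc loc; apply: leq_trans tM _; apply: leq_bigmax.
have [r0 _] : exists r0 : nat -> G, True.
  have := nwin 0; rewrite /wins_within => /existsNP[r _]; by exists r.
have good0 : good 0 r0.
  move=> m; have := nwin m => /existsNP[r /not_implyP[rw nloc]].
  exists r; split=> // t tm loc; apply: nloc; by exists t.
have /choice[F hF] : forall nq : nat * (nat -> G), exists q', good nq.1 nq.2 ->
    good nq.1.+1 q' /\ forall i, i < nq.1 -> q' i = nq.2 i.
  move=> [n q]; have [gq|] := pselect (good n q); last by exists q.
  by have [q' hq'] := good_ext n q gq; exists q'.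
pose Q := fix Q n := if n is n'.+1 then F (n', Q n') else r0.
have goodQ n : good n (Q n).
  by elim: n => // n IH; have [] := hF (n, Q n) IH.
have QS n i : i < n -> Q n.+1 i = Q n i.
  by have [_] := hF (n, Q n) (goodQ n); exact.
pose r i := Q i.+1 i.
have Qr n i : i < n -> Q n i = r i.
  elim: n => // n IH; rewrite ltnS leq_eqVlt => /orP[/eqP ->//|lt].
  by rewrite QS // IH.
have rw : robber_walk r.
  move=> t; have [p [pw pq _]] := goodQ t.+2 0.
  by rewrite -(Qr t.+2 t) // -(Qr t.+2 t.+1) // -!pq //; apply: pw.
have [t loc] := win r rw.
have [p [pw pq ploc]] := goodQ t.+1 t.+1.
apply: (ploc t) => //; apply: eq_located loc => i it.
by rewrite pq // Qr.
Qed.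

Lemma ex_cops_win_within k : cops_win k -> exists m, `[< cops_win_within k m >].
Proof.
case=> s /winning_strategy_within[m sm]; exists m; apply/asboolP.
by exists s.
Qed.

Definition lcapt_with (k : nat) (win : cops_win k) : nat :=
  ex_minn (ex_cops_win_within win).

Definition lcapt : nat := lcapt_with localization_numberP.

End LocalizationGame.

(* Main.v *)
Require Import Defs.
From mathcomp Require Import all_boot zify.
From mathcomp Require Import boolp.

Set Implicit Arguments.
Unset Strict Implicit.
Unset Printing Implicit Defensive.

(* Upper bound.  Root the tree at the root of the copy of T_{3,3} and write
   meet x y for the depth of the last common ancestor of x and y, so that
   d(x, y) = depth x + depth y - 2 meet x y.  Probing two leaves a and b reveals
   the projection of the robber on the path from a to b and its distance to that
   path: the candidates are then level, and lie in branches hanging from a single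
   vertex.  If two candidates are left, pick two of them, x and y, with meet x y
   minimal, and probe leaves below x and y next: all candidates stay below the
   branching point of the new path, so there is no ambiguity between going up and
   going down, and two more leaves are discarded.  The first probe uses leaves
   below two children of the root and leaves at most l(T) - 4 leaves in play,
   since each branching vertex of the copy carries leaves off the path.

   Lower bound.  One cop never wins, because the robber can maintain as candidates
   either two children of the root or the root and a leaf of the copy: for any
   probed vertex c, at most one neighbour of a vertex z is not farther from c
   than z. *)

(** * Distances and neighbours in a tree *)

Section TreeDistance.
Variable T : sgraph.
Hypothesis T_tree : is_tree T.
Implicit Types (c u x y z : T) (p : seq T).

Lemma dist_le_size x p : path (@adj T) x p -> dist x (last x p) <= size p.
Proof.
move=> xp; rewrite /dist.
(* A path too long for the search range is no obstacle: [find] never exceeds [#|T|]. *)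
have [lt|ge] := ltnP (size p) #|T|; last first.
  by apply: leq_trans ge; rewrite -[X in _ <= X](size_iota 0) find_size.
rewrite leqNgt; apply/negP => /(before_find 0).
rewrite nth_iota // add0n => /negbT/existsP[].
by exists (in_tuple p); rewrite xp eqxx.
Qed.

Lemma geodesic x y :
  exists p, [/\ path (@adj T) x p, last x p = y & size p = dist x y].
Proof.
have [[_ /(_ x y)/connectP[p xp ->]] _] := T_tree.
(* Without repetitions the path has length below [#|T|], so the search defining [dist] succeeds. *)
have [q xq uq _] := shortenP xp.
have lt : size q < #|T| by have := max_card (mem (x :: q)); rewrite (card_uniqP uq).
have hw : has (fun n => walk_of_length n x (last x q)) (iota 0 #|T|).
  apply/hasP; exists (size q); first by rewrite mem_iota.
  by apply/existsP; exists (in_tuple q); rewrite xq eqxx.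
have := nth_find 0 hw; rewrite -/(dist x (last x q)) nth_iota; last first.
  by move: hw; rewrite has_find size_iota.
rewrite add0n => /existsP[w /andP[xw /eqP lw]].
by exists w; rewrite size_tuple.
Qed.

Lemma dist_triangle x y z : dist x z <= dist x y + dist y z.
Proof.
have [p [xp py <-]] := geodesic x y; have [q [yq qz <-]] := geodesic y z.
by rewrite -size_cat -qz -py -last_cat dist_le_size // cat_path xp py.
Qed.

Lemma dist_adj_le x y : adj x y -> dist x y <= 1.
Proof. by move=> xy; have := @dist_le_size x [:: y]; rewrite /= xy; apply. Qed.

Lemma dist_edge c x y : adj x y -> dist c y <= (dist c x).+1.
Proof.
by move=> /dist_adj_le xy; have := dist_triangle c x y; lia.
Qed.

Lemma dist_sym x y : dist x y = dist y x.
Proof.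
suff le (a b : T) : dist a b <= dist b a by apply/eqP; rewrite eqn_leq !le.
have [p [bp pa <-]] := geodesic b a.
have := @dist_le_size a (rev (belast b p)).
rewrite size_rev size_belast -pa rev_path.
under eq_path do rewrite adj_sym.
rewrite bp => /(_ isT).
suff -> : last (last b p) (rev (belast b p)) = b by [].
by case: (p) => //= z q; rewrite rev_cons last_rcons.
Qed.

Lemma exists_closer c z : z != c -> exists2 y, adj z y & dist c z = (dist c y).+1.
Proof.
move=> zc; have [p [cp pz sp]] := geodesic c z.
case/lastP: p cp pz sp => [_ /= cz|p w]; first by rewrite cz eqxx in zc.
rewrite rcons_path last_rcons size_rcons => /andP[cp aw] <- sp.
exists (last c p); first by rewrite adj_sym.
apply/eqP; rewrite eqn_leq dist_edge //= -sp ltnS.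
exact: dist_le_size.
Qed.

Lemma closer_path c z : 
  exists p, [/\ path (@adj T) z p, last z p = c & {in p, forall y, dist c y < dist c z}].
Proof.
have [n] := ubnP (dist c z); elim: n z => // n IH z ltn.
have [->|zc] := eqVneq z c; first by exists [::].
have [y zy dz] := exists_closer zc.
have [|p [yp pc lp]] := IH y; first by lia.
exists (y :: p); split=> //=; first by rewrite zy.
move=> w; rewrite inE => /predU1P[->|/lp]; lia.
Qed.

(** If [y1] and [y2] differed, the shortened path closed up through [z] would be a cycle on at least
    three vertices. *)
Lemma no_detour z y1 y2 p : adj z y1 -> adj z y2 -> path (@adj T) y1 p ->
  last y1 p = y2 -> z \notin y1 :: p -> y1 = y2.
Proof.
move=> zy1 zy2 yp lp zp; apply/eqP; apply: contraT => y12.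
have [_ /(_ _ _)acyc] := T_tree.
move: lp; have [q yq uq sq] := shortenP yp => lq.
have zq : z \notin y1 :: q.
  apply: contra zp; rewrite !inE => /orP[->//|/sq ->]; exact: orbT.
suff : size (z :: y1 :: q) < 3.
  by case: (q) lq => //= y12'; rewrite y12' eqxx in y12.
apply: acyc; rewrite /ucycle /= rcons_path zy1 yq lq adj_sym zy2 /=.
by move: uq => /= ->; rewrite zq.
Qed.

(** Descending paths from [y1] and [y2] to [c] stay strictly closer to [c] than [z] after their
    first vertex. Joined at [c], they avoid [z], so [no_detour] applies. *)
Lemma closer_unique c z y1 y2 : adj z y1 -> adj z y2 ->
  dist c y1 <= dist c z -> dist c y2 <= dist c z -> y1 = y2.
Proof.
move=> zy1 zy2 d1 d2.
have [p [yp pc lp]] := closer_path c y1; have [q [yq qc lq]] := closer_path c y2.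
have ne y : adj z y -> z != y by apply: contraTneq => ->; rewrite adj_irr.
have rq : last c (rev (belast y2 q)) = y2.
  by rewrite -qc; case: (q) => //= w s; rewrite rev_cons last_rcons.
apply: (@no_detour z y1 y2 (p ++ rev (belast y2 q))) => //.
- rewrite cat_path yp pc -qc rev_path.
  by under eq_path do rewrite adj_sym.
- by rewrite last_cat pc.
- rewrite inE negb_or ne //= mem_cat negb_or mem_rev; apply/andP; split.
    by apply/negP => /lp; rewrite ltnNge d1.
  apply/negP => /mem_belast; rewrite inE (negPf (ne _ zy2)) /= => /lq.
  by rewrite ltnNge d2.
Qed.

(** With equal distances, [y] would coincide with the neighbour of [x] that is strictly closer to
    [c]. *)
Lemma dist_edge_neq c x y : adj x y -> dist c x != dist c y.
Proof.
move=> xy; apply/eqP => dxy.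
have xc : x != c.
  apply: contraTneq xy => xc; move: dxy; rewrite xc distxx => /esym/dist_eq0 ->.
  by rewrite adj_irr.
have [z xz dz] := exists_closer xc.
have yz : y = z by apply: (closer_unique (c := c) xy xz); lia.
by move: dxy; rewrite yz; lia.
Qed.

Lemma farther_of_closer c z y1 y2 : adj z y1 -> adj z y2 -> y1 != y2 ->
  dist c y1 <= dist c z -> dist c y2 = (dist c z).+1.
Proof.
move=> zy1 zy2 y12 d1; apply/eqP; rewrite eqn_leq dist_edge //= ltnNge.
by apply: contra y12 => d2; apply/eqP/(closer_unique zy1 zy2 d1 d2).
Qed.

End TreeDistance.

(** * Ancestors, meets and leaves in a rooted tree *)

Section RootedTree.
Variable T : sgraph.
Hypothesis T_tree : is_tree T.
Variable u : T.
Implicit Types (a b l x y z : T) (i j : nat).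

Definition par z : T := odflt z [pick y | adj z y && (dist u z == (dist u y).+1)].

Lemma parP z : z != u -> adj z (par z) /\ dist u z = (dist u (par z)).+1.
Proof.
move=> zu; rewrite /par; case: pickP => [y /andP[zy /eqP]//|nz].
have [y zy dz] := exists_closer T_tree zu.
by have := nz y; rewrite zy dz eqxx.
Qed.

Lemma par_eq y z : adj z y -> dist u y < dist u z -> par z = y.
Proof.
move=> zy dyz; have [|zp dz] := @parP z.
  by apply: contraTneq dyz => ->; rewrite distxx.
by apply: (closer_unique T_tree zp zy (c := u)); lia.
Qed.

(** The index counts from the root, so that ancestors of two vertices are compared at equal depth.
    For [i] beyond the depth of [z], the truncated subtraction yields [z] itself. *)
Definition anc i z : T := iter (dist u z - i) par z.

Lemma anc_dist z : anc (dist u z) z = z.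
Proof. by rewrite /anc subnn. Qed.

Lemma anc_par i z : i < dist u z -> anc i z = anc i (par z).
Proof.
move=> iz; have [|_ dz] := @parP z.
  by apply: contraTneq iz => ->; rewrite distxx.
by rewrite /anc dz subSn -?iterSr //; lia.
Qed.

Lemma par_anc i z : i < dist u z -> par (anc i.+1 z) = anc i z.
Proof.
by move=> iz; rewrite /anc (_ : dist u z - i = (dist u z - i.+1).+1) //; lia.
Qed.

Lemma dist_anc i z : i <= dist u z -> dist u (anc i z) = i.
Proof.
have [n] := ubnP (dist u z); elim: n z => // n IH z ltn.
rewrite leq_eqVlt => /predU1P[->|iz]; first by rewrite anc_dist.
have [|_ dz] := @parP z; first by apply: contraTneq iz => ->; rewrite distxx.
by rewrite anc_par // IH //; lia.
Qed.

Lemma anc_anc i j z : i <= j -> j <= dist u z -> anc i (anc j z) = anc i z.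
Proof.
move=> ij jz; rewrite {1}/anc dist_anc // /anc -iterD; congr iter; lia.
Qed.

(* The depth of the last common ancestor of x and y. *)
Definition meet x y : nat :=
  \max_(i < (minn (dist u x) (dist u y)).+1 | anc i x == anc i y) i.

Lemma meetC x y : meet x y = meet y x.
Proof.
by rewrite /meet minnC; apply: eq_bigl => i; rewrite eq_sym.
Qed.

Lemma anc0 z : anc 0 z = u.
Proof. by apply/esym/dist_eq0/dist_anc. Qed.

Lemma meet_ub x y : meet x y <= minn (dist u x) (dist u y).
Proof. by apply/bigmax_leqP => i _; rewrite -ltnS. Qed.

Lemma meet_lel x y : meet x y <= dist u x.
Proof. by apply: leq_trans (meet_ub x y) (geq_minl _ _). Qed.

Lemma meet_ler x y : meet x y <= dist u y.
Proof. by rewrite meetC meet_lel. Qed.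

Lemma anc_meet x y : anc (meet x y) x = anc (meet x y) y.
Proof.
rewrite /meet.
have [|i Pi ->] := @eq_bigmax_cond 'I_(minn (dist u x) (dist u y)).+1
    [pred i : 'I_(minn (dist u x) (dist u y)).+1 | anc i x == anc i y] (@nat_of_ord _).
  by apply/card_gt0P; exists ord0; rewrite inE !anc0.
exact/eqP.
Qed.

Lemma meet_geP i x y : i <= dist u x -> i <= dist u y ->
  (i <= meet x y) = (anc i x == anc i y).
Proof.
move=> ix iy; apply/idP/eqP => [im|/eqP aE].
  by rewrite -(anc_anc im (meet_lel x y)) -(anc_anc im (meet_ler x y)) anc_meet.
have im : i < (minn (dist u x) (dist u y)).+1 by rewrite ltnS leq_min ix.
exact: (@leq_bigmax_cond _ _ (@nat_of_ord _) (Ordinal im)).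
Qed.

Lemma meetxx x : meet x x = dist u x.
Proof. by apply/eqP; rewrite eqn_leq meet_lel meet_geP /=. Qed.

Lemma meet_ultra x y z : minn (meet x y) (meet y z) <= meet x z.
Proof.
set m := minn _ _.
have m1 : m <= meet x y := geq_minl _ _.
have m2 : m <= meet y z := geq_minr _ _.
have mx := leq_trans m1 (meet_lel x y); have my := leq_trans m1 (meet_ler x y).
have mz := leq_trans m2 (meet_ler y z).
by move: m1 m2; rewrite !meet_geP // => /eqP ->.
Qed.

Lemma meet_inj x y : dist u x = dist u y -> dist u x <= meet x y -> x = y.
Proof.
move=> dxy; rewrite meet_geP ?dxy // -{1}dxy !anc_dist; exact/eqP.
Qed.

Lemma meet_adj x y : adj x y -> meet x y = minn (dist u x) (dist u y).
Proof.
wlog lt : x y / dist u x < dist u y => [H xy|].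
  have /orP[lt|lt] : (dist u x < dist u y) || (dist u y < dist u x).
    by have := dist_edge_neq T_tree u xy; lia.
    exact: H.
  by rewrite meetC minnC H // adj_sym.
rewrite adj_sym => yx; have le := ltnW lt.
apply/eqP; rewrite eqn_leq meet_ub /= (minn_idPl le) meet_geP //.
by rewrite (anc_par lt) (par_eq yx lt).
Qed.

Lemma dist_ancestor i a : i <= dist u a -> dist a (anc i a) = dist u a - i.
Proof.
move=> ia; have [p1] : exists n, dist u a - i = n by eexists.
elim: p1 i ia => [|n IH] i ia E.
  have -> : i = dist u a by lia.
  by rewrite anc_dist distxx subnn.
have aS : anc i.+1 a != u.
  apply/eqP => /(congr1 (dist u)); rewrite dist_anc ?distxx //; lia.
have [ap dp] := parP aS.
have paE : par (anc i.+1 a) = anc i a by apply: par_anc; lia.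
apply/eqP; rewrite eqn_leq; apply/andP; split.
  have := IH i.+1; have := dist_edge T_tree a ap; rewrite paE; lia.
have := dist_triangle T_tree u (anc i a) a.
by rewrite dist_anc // [dist (anc i a) a](dist_sym T_tree); lia.
Qed.

(** Induction on the depth of [z]. Unless [z] is an ancestor of [a], its parent has the same meet
    with [a], and [z] is one step farther from [a]: the parent either is [a] or has another
    neighbour closer to [a], namely its own parent or, when it lies above [a], its child towards
    [a]. *)
Lemma dist_meet a z : dist a z = (dist u a - meet a z) + (dist u z - meet a z).
Proof.
have [n] := ubnP (dist u z); elim: n z => // n IH z ltn.
have [mz|] := eqVneq (meet a z) (dist u z).
  rewrite mz subnn addn0 -{1}(anc_dist z) -mz -anc_meet dist_ancestor //.
  exact: meet_lel.
move=> mz; have {}mz : meet a z < dist u z by have := meet_ler a z; lia.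
have zu : z != u by apply: contraTneq mz => ->; rewrite distxx.
have [zp dz] := parP zu.
have mp : meet a (par z) = meet a z.
  apply/eqP; rewrite eqn_leq.
  have := meet_adj zp; have := meet_ultra a (par z) z; have := meet_ultra a z (par z).
  rewrite (meetC (par z) z); have := meet_ler a (par z); lia.
have [az|az] := eqVneq (par z) a.
  move: zp dz mp; rewrite adj_sym az => zp dz; rewrite meetxx => mp.
  have := dist_edge_neq T_tree a zp; have := dist_adj_le zp.
  by rewrite distxx; lia.
have IHp := IH (par z); rewrite mp in IHp.
suff : dist a z = (dist a (par z)).+1 by lia.
have [mpz|mpz] := ltnP (meet a z) (dist u (par z)).
  have pu : par z != u by apply: contraTneq mpz => ->; rewrite distxx.
  have [pp dp] := parP pu.
  apply: (@farther_of_closer _ T_tree a (par z) (par (par z))) => //.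
  - by rewrite adj_sym.
  - by apply/eqP => E; move: dp; rewrite E; lia.
  - have mpp : meet a (par (par z)) = meet a z.
      apply/eqP; rewrite eqn_leq.
      have := meet_adj pp; have := meet_ultra a (par (par z)) (par z).
      have := meet_ultra a (par z) (par (par z)).
      rewrite (meetC (par (par z)) (par z)); have := meet_ler a (par (par z)); lia.
    by have := IH (par (par z)); rewrite mpp; lia.
have pzE : par z = anc (meet a z) a.
  by rewrite -mp anc_meet mp -{1}(anc_dist (par z)); congr anc; have := meet_ler a (par z); lia.
have ma : meet a z < dist u a.
  rewrite ltn_neqAle meet_lel andbT; apply: contra az => /eqP ma.
  by rewrite pzE ma anc_dist.
set w := anc (meet a z).+1 a.
have dw : dist u w = (meet a z).+1 by apply: dist_anc.
have wu : w != u by apply/eqP => E; move: dw; rewrite E distxx.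
have [wp dwp] := parP wu.
have wpE : par w = par z by rewrite pzE par_anc.
apply: (@farther_of_closer _ T_tree a (par z) w) => //.
- by rewrite -wpE adj_sym.
- by rewrite adj_sym.
- apply/eqP => E; have := @meet_geP (meet a z).+1 a z ma mz.
  by rewrite ltnn -/w -dw E anc_dist eqxx.
- by rewrite pzE /w !dist_ancestor; lia.
Qed.

Lemma dist_meetD a z : dist a z + (meet a z).*2 = dist u a + dist u z.
Proof.
by rewrite dist_meet; have := meet_lel a z; have := meet_ler a z; lia.
Qed.

Lemma meet_trans n x y z : n <= meet x y -> n <= meet y z -> n <= meet x z.
Proof. by move=> xy yz; apply: leq_trans (meet_ultra x y z); rewrite leq_min xy. Qed.

(** A deepest descendant of [x] works: a neighbour other than its parent would be a deeper
    descendant. It is not the root because [x] is not, so it does have a parent. *)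
Lemma exists_leaf_below x : x != u ->
  exists2 l, l \in leaves T & meet x l = dist u x.
Proof.
move=> xu; pose P := [pred l | meet x l == dist u x].
have Px : P x by rewrite /= meetxx.
case: (@arg_maxnP _ x P (dist u) Px) => l /eqP ml lmax; exists l => //.
have lu : l != u.
  apply/eqP => lu; have := meet_ler x l; rewrite ml lu distxx leqn0 => /eqP/dist_eq0 E.
  by rewrite E eqxx in xu.
have [lp dl] := parP lu.
rewrite inE /degree; apply/cards1P; exists (par l); apply/setP => y; rewrite !inE.
apply/idP/eqP => [ly|->//]; apply: esym; apply: par_eq => //.
have := dist_edge_neq T_tree u ly; rewrite neq_ltn => /orP[lt|//].
have Py : P y.
  rewrite /= eqn_leq meet_lel /=.
  by have := meet_ultra x l y; rewrite ml (meet_adj ly); have := meet_ler x l; lia.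
by have := lmax y Py; lia.
Qed.

End RootedTree.

(** * The game in terms of sets of candidate positions *)

Section CandidateSets.
Variable G : sgraph.
Implicit Types (X Y : {set G}) (r : nat -> G).

Definition closed_nbhd X : {set G} :=
  [set y | [exists x in X, (y == x) || adj x y]].

Definition probe_answer k (c : k.-tuple G) (x : G) : k.-tuple nat :=
  [tuple of [seq dist v x | v <- c]].

Definition consistent k X (c : k.-tuple G) (a : k.-tuple nat) : {set G} :=
  [set x in X | probe_answer c x == a].

Lemma closed_nbhd_walk r t X : robber_walk r -> r t \in X -> r t.+1 \in closed_nbhd X.
Proof.
move=> rw rX; rewrite inE; apply/existsP; exists (r t); rewrite rX /=.
by case: (rw t) => [->|->]; rewrite ?eqxx ?orbT.
Qed.

(** Here [X] holds the possible positions just before a probe, hence the closed neighbourhood in the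
    recursive call. At least one probe is required, even for a singleton [X]. *)
Fixpoint wins_from k m X : Prop :=
  if m is m'.+1 then
    exists c : k.-tuple G, forall a,
      #|consistent X c a| <= 1 \/ wins_from k m' (closed_nbhd (consistent X c a))
  else False.

Section Strategy.
Variables (k : nat) (P : nat -> {set G} -> k.-tuple G).

Definition candidate_step (mX : nat * {set G}) a :=
  (mX.1.-1, closed_nbhd (consistent mX.2 (P mX.1 mX.2) a)).

(** A strategy sees only the past answers, so the probes left and the candidate set are recomputed
    by replaying them. *)
Definition candidates m h := foldl candidate_step (m, setT) h.

Definition candidate_strategy m : strategy G k :=
  fun h => P (candidates m h).1 (candidates m h).2.

Lemma candidatesS m r t :
  let h := answers (candidate_strategy m) r in
  candidates m (h t.+1) =
    candidate_step (candidates m (h t)) (probe_answer (candidate_strategy m (h t)) (r t)).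
Proof. by rewrite /= /candidates foldl_rcons. Qed.

Lemma mem_candidates m r t : robber_walk r ->
  r t \in (candidates m (answers (candidate_strategy m) r t)).2.
Proof.
move=> rw; elim: t => [|t IH]; first by rewrite inE.
rewrite candidatesS; apply: closed_nbhd_walk => //.
by rewrite inE IH /= eqxx.
Qed.

Lemma located_candidates m r t :
  let h := answers (candidate_strategy m) r t in
  let mX := candidates m h in
  robber_walk r ->
  #|consistent mX.2 (P mX.1 mX.2) (probe_answer (candidate_strategy m h) (r t))| <= 1 ->
  located (candidate_strategy m) r t.
Proof.
move=> h mX rw /card_le1_eqP le1 r' rw' /rcons_inj E.
have h' : answers (candidate_strategy m) r' t = h := congr1 fst E.
have aE : probe_answer (candidate_strategy m (answers (candidate_strategy m) r' t)) (r' t)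
  = probe_answer (candidate_strategy m h) (r t) := congr1 snd E.
rewrite h' in aE.
have rX := @mem_candidates m r' t rw'; rewrite h' in rX.
by apply: le1; rewrite inE; [rewrite (mem_candidates m t rw) eqxx | rewrite rX -aE eqxx].
Qed.

End Strategy.

Lemma wins_from_within k m : wins_from k m setT -> cops_win_within G k m.
Proof.
move=> win.
(* For losing pairs any tuple will do; the first probe provided by [win] serves as the default. *)
have /choice[P hP] : forall mX : nat * {set G}, exists c : k.-tuple G,
    wins_from k mX.1 mX.2 -> forall a, #|consistent mX.2 c a| <= 1 \/
      wins_from k mX.1.-1 (closed_nbhd (consistent mX.2 c a)).
  case=> [[|n] X] /=.
    case: m win => // m [c _]; by exists c.
  have [[c hc]|nw] := pselect (wins_from k n.+1 X); first by exists c.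
  by case: m win => // m [c _]; exists c => /nw.
pose Q n X := P (n, X).
have hQ n X : wins_from k n X -> forall a, #|consistent X (Q n X) a| <= 1 \/
    wins_from k n.-1 (closed_nbhd (consistent X (Q n X) a)) := hP (n, X).
exists (candidate_strategy Q m) => r rw; apply: contrapT => nloc.
have H t : t <= m -> let mX := candidates Q m (answers (candidate_strategy Q m) r t) in
    mX.1 = m - t /\ wins_from k mX.1 mX.2.
  elim: t => [|t IH] tm; first by rewrite subn0.
  have [E1 w1] := IH (ltnW tm); rewrite candidatesS; split; first by rewrite /= E1; lia.
  have [le1|//] := hQ _ _ w1
    (probe_answer (candidate_strategy Q m (answers (candidate_strategy Q m) r t)) (r t)).
  by case: nloc; exists t => //; apply: located_candidates.
by have [E] := H m (leqnn _); rewrite E subnn.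
Qed.

(** The robber commits to no walk: each probe gets an answer that keeps a set of [F] possible, hence
    at least two positions. By [winning_strategy_within] a winning strategy has bounded duration, so
    surviving that many rounds refutes it. *)
Lemma evasion k (F : {set G} -> Prop) (X0 : {set G}) :
  F X0 -> (forall X, F X -> 1 < #|X|) ->
  (forall X (c : k.-tuple G), F X -> exists a Y,
      F Y /\ Y \subset consistent (closed_nbhd X) c a) ->
  ~ cops_win G k.
Proof.
move=> F0 F2 Fstep [s /winning_strategy_within[m sm]].
(* After [t] answers, [X] describes the positions at the last probe, numbered [t.-1]; for [t = 0]
   there is no such probe and the condition is void. *)
have H t : exists h X, F X /\ forall x, x \in X -> exists r,
    [/\ robber_walk r, answers s r t = h, 0 < t -> r t.-1 = x &
    forall i, i < t -> ~ located s r i].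
  elim: t => [|t [h [X [FX hX]]]].
    exists [::], X0; split=> // y _; exists (fun=> y); split=> //.
    by move=> ?; left.
  have [a [Y [FY /subsetP YX]]] := Fstep X (s h) FX.
  have reach y : y \in Y -> exists r, [/\ robber_walk r,
      answers s r t.+1 = rcons h a, r t = y & forall i, i < t -> ~ located s r i].
    move=> /YX; rewrite !inE => /andP[/existsP[x /andP[/hX[r [rw rh rx nloc]] xy]] /eqP ya].
    pose q i := if i < t then r i else y.
    have qr i : i < t -> r i = q i by rewrite /q => ->.
    have qt : q t = y by rewrite /q ltnn.
    exists q; split=> //.
    - move=> i; rewrite /q; case: (ltngtP i.+1 t) => it.
      + by apply: rw.
      + by left.
      + move: rx; rewrite -it => /(_ isT) /= ->.
        by case/orP: xy => [/eqP|]; [left|right].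
    - rewrite /= -(eq_answers s qr) rh -ya.
      by congr rcons; apply: val_inj; rewrite /= qt.
    - move=> i it loc; apply: (nloc i it); apply: eq_located loc => j ji.
      by rewrite qr // (leq_ltn_trans ji).
  exists (rcons h a), Y; split=> // y yY; have [r [rw rh ry nloc]] := reach y yY.
  exists r; split=> // i; rewrite ltnS leq_eqVlt => /predU1P[-> loc|/nloc//].
  (* Two distinct vertices of [Y] are reached by walks with the same answers, so the latest probe
     locates nobody. *)
  have /card_gt1P[y1 [y2 [y1Y y2Y /eqP]]] := F2 Y FY; case.
  have [r1 [rw1 rh1 <- _]] := reach y1 y1Y; have [r2 [rw2 rh2 <- _]] := reach y2 y2Y.
  by rewrite (loc r1) ?(loc r2) // rh ?rh1 ?rh2.
have [h [X [FX hX]]] := H m.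
have /card_gt1P[x [_ [/hX[r [rw _ _ nloc]] _ _]]] := F2 X FX.
by have [t /nloc] := sm r rw.
Qed.

End CandidateSets.

(** * Two cops against a confined robber *)

Section TwoCops.
Variable T : sgraph.
Hypothesis T_tree : is_tree T.
Variable u : T.
Implicit Types (X Y A : {set T}) (a b l x y z : T).
Local Notation depth := (dist u).
Local Notation meet := (meet u).

(* Robbers in X are level at depth d, below a common vertex of depth e, and A
   contains all leaves of the branches at that vertex which meet X. *)
Definition confined X A := exists e d, [/\ e < d,
  {in X, forall x, depth x = d},
  {in X &, forall x y, e <= meet x y} &
  {in X & leaves T, forall x l, e < meet x l -> l \in A}].

Lemma meet_closed_nbhd X z : z \in closed_nbhd X ->
  exists2 x, x \in X & minn (depth x) (depth z) <= meet x z /\ depth x <= (depth z).+1.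
Proof.
rewrite inE => /existsP[x /andP[xX /orP[/eqP ->|xz]]]; exists x => //.
  by rewrite meetxx // minnn; split=> //; lia.
by rewrite meet_adj //; split=> //; apply: dist_edge; rewrite // adj_sym.
Qed.

Definition pair_probe a b : 2.-tuple T := [tuple a; b].

Lemma pair_probe_inj a b x y : probe_answer (pair_probe a b) x = probe_answer (pair_probe a b) y ->
  dist a x = dist a y /\ dist b x = dist b y.
Proof. by move/(congr1 val) => /= [-> ->]. Qed.

(* Below the branching point of a and b, the smaller of the meets with a and
   with b is meet a b, and the probe reveals their difference. *)
Lemma two_probe_levels a b x y :
  meet a b <= meet x a -> meet a b <= meet x b ->
  meet a b <= meet y a -> meet a b <= meet y b ->
  dist a x = dist a y -> dist b x = dist b y ->
  [/\ depth x = depth y, meet x a = meet y a & meet x b = meet y b].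
Proof.
have low z : meet z a <= meet a b \/ meet z b <= meet a b.
  have := meet_ultra T_tree u a z b; rewrite (meetC u a z) geq_min.
  by case/orP; [left|right].
have := dist_meetD T_tree u a x; have := dist_meetD T_tree u a y.
have := dist_meetD T_tree u b x; have := dist_meetD T_tree u b y.
rewrite !(meetC u a) !(meetC u b _).
move: (low x) (low y); rewrite !(meetC u _ a) !(meetC u _ b).
move: (meet a x) (meet a y) (meet b x) (meet b y) (meet b a).
move: (dist a x) (dist a y) (dist b x) (dist b y).
move: (depth x) (depth y) (depth a) (depth b).
clear; move=> *; split; lia.
Qed.

(** The hypothesis places [X] below the branching vertex of [a] and [b], where [two_probe_levels]
    applies. The number [e] is the depth of the common projection of the candidates on the path from
    [a] to [b]. *)
Lemma confined_after_probe X a b k :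
  {in X, forall z, meet a b <= meet z a /\ meet a b <= meet z b} ->
  let Y := consistent X (pair_probe a b) k in
  #|Y| <= 1 \/ exists e, [/\ meet a b <= e,
    {in Y, forall y, e = maxn (meet y a) (meet y b)} &
    confined Y [set l in leaves T | [exists y in Y, e < meet y l]] /\
    {in Y, forall y, e < depth y}].
Proof.
move=> Xab Y; have [|] := leqP #|Y| 1; first by left.
move=> /card_gt1P[y0 [y1 [y0Y y1Y y01]]]; right.
have same x y : x \in Y -> y \in Y ->
    [/\ depth x = depth y, meet x a = meet y a & meet x b = meet y b].
  rewrite !inE => /andP[/Xab[xa xb] /eqP xk] /andP[/Xab[ya yb] /eqP yk].
  have [da db] : dist a x = dist a y /\ dist b x = dist b y.
    by apply: pair_probe_inj; rewrite xk yk.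
  exact: two_probe_levels.
set e := maxn (meet y0 a) (meet y0 b).
have eY y : y \in Y -> e = maxn (meet y a) (meet y b).
  by move=> /(same y0 y y0Y)[_ <- <-].
(* The maximum [e] is attained at the same one of [a] and [b] for all candidates, so they share its
   ancestor at depth [e]. *)
have eYY x y : x \in Y -> y \in Y -> e <= meet x y.
  move=> xY yY; have := meet_ultra T_tree u x a y; have := meet_ultra T_tree u x b y.
  rewrite !(meetC u _ y); have := eY x xY; have := eY y yY.
  have [_ -> ->] := same _ _ xY yY; lia.
have lt : e < depth y0.
  rewrite ltnNge; apply: contra y01 => le; apply/eqP; apply: (@meet_inj _ T_tree u).
    by have [] := same _ _ y0Y y1Y.
  exact: leq_trans le (eYY _ _ _ _).
have ltY y : y \in Y -> e < depth y by move=> yY; have [<-] := same _ _ y0Y yY.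
exists e; split=> //.
  have : y0 \in X by move: y0Y; rewrite inE => /andP[].
  by move/Xab; rewrite /e; lia.
split=> //; exists e, (depth y0); split=> //.
- by move=> y yY; have [<-] := same _ _ y0Y yY.
- move=> y l yY lT lt'; rewrite inE lT /=; apply/existsP; exists y.
  by rewrite yY.
Qed.

Lemma confinedS X A A2 : A \subset A2 -> confined X A -> confined X A2.
Proof.
move=> /subsetP AB [e [d [ed Xd Xe XA]]]; exists e, d; split=> // x l xX lT lt.
exact/AB/(XA x).
Qed.

Lemma depth_neq_root x n : n < depth x -> x != u.
Proof. by apply: contraTneq => ->; rewrite distxx. Qed.

Lemma confined_probe X A : confined X A -> 1 < #|X| ->
  exists a b, [/\ a \in A, b \in A, a != b & forall k,
    let Y := consistent (closed_nbhd X) (pair_probe a b) k in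
    #|Y| <= 1 \/ confined Y (A :\ a :\ b)].
Proof.
move=> [e [d [ed Xd Xe XA]]] /card_gt1P[x0 [y0 [x0X y0X xy0]]].
pose P := [pred xy : T * T | (xy.1 \in X) && (xy.2 \in X)].
have P0 : P (x0, y0) by rewrite /= x0X.
case: (@arg_minnP _ (x0, y0) P (fun xy => meet xy.1 xy.2) P0) => -[x y] /= /andP[xX yX] xymin.
have {}xymin z t : z \in X -> t \in X -> meet x y <= meet z t.
  by move=> zX tX; apply: (xymin (z, t)); rewrite /= zX.
have md : meet x y < d.
  rewrite ltnNge; apply: contra xy0 => le; apply/eqP/(@meet_inj _ T_tree u).
    by rewrite !Xd.
  by rewrite Xd //; apply: leq_trans le (xymin _ _ _ _).
have [|a aT] := @exists_leaf_below _ T_tree u x.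
  by apply: (@depth_neq_root _ e); rewrite Xd.
rewrite Xd // => xa.
have [|b bT] := @exists_leaf_below _ T_tree u y.
  by apply: (@depth_neq_root _ e); rewrite Xd.
rewrite Xd // => yb.
have ab : meet a b = meet x y.
  have := meet_ultra T_tree u a x b; have := meet_ultra T_tree u x y b.
  have := meet_ultra T_tree u x a y; have := meet_ultra T_tree u a b y.
  rewrite (meetC u a x) (meetC u b y); lia.
exists a, b; split.
- by apply: (XA x) => //; rewrite xa.
- by apply: (XA y) => //; rewrite yb.
- apply: contraTneq md => E; rewrite -leqNgt -ab -E (meetxx T_tree).
  by rewrite -xa meet_ler.
move=> k; have [z|le1|] := @confined_after_probe (closed_nbhd X) a b k.
  (* A move reaches depth [d - 1] at the highest, which is still at least [meet x y]. *)
  case/meet_closed_nbhd => x' x'X [+ le]; rewrite Xd // => x'z; rewrite Xd // in le.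
  have := xymin x x' xX x'X; have := xymin y x' yX x'X.
  have := meet_ultra T_tree u z x' x; have := meet_ultra T_tree u z x' y.
  have := meet_ultra T_tree u z x a; have := meet_ultra T_tree u z y b.
  rewrite (meetC u z x') (meetC u x' x) (meetC u x' y) ab; lia.
  by left.
set Y := consistent _ _ _ => -[f [mf Yf [conf Yd]]]; right.
apply: confinedS conf; apply/subsetP => l; rewrite !inE => /andP[lT /existsP[z /andP[zY fl]]].
have := Yf z zY; have := Yd z zY; move=> dz fE.
(* A candidate meets [a] and [b] at depth at most [f], but [l] deeper than [f]. *)
have la : l != a by apply: contraTneq fl => ->; lia.
have lb : l != b by apply: contraTneq fl => ->; lia.
rewrite la lb /=.
(* The previous position [x'] of [z] still shares with [l] an ancestor deeper than [e], so [l] was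
   already in [A]. *)
move: zY; rewrite inE => /andP[/meet_closed_nbhd[x' x'X [+ _]] _]; rewrite Xd // => x'z.
apply: (XA x'); rewrite ?inE //; have := meet_ultra T_tree u x' z l.
have := Xe x y xX yX; lia.
Qed.

(** Each probe removes two leaves from [A]. Once at most one is left, [confined_probe] cannot supply
    two distinct leaves, so at most one candidate remains. *)
Lemma confined_wins g X A : confined X A -> #|A| <= g.*2.+1 ->
  #|X| <= 1 \/ wins_from 2 g (closed_nbhd X).
Proof.
elim: g X A => [|g IH] X A conf cA; have [|X1] := leqP #|X| 1; try by left.
all: have [a [b [aA bA ab abP]]] := confined_probe conf X1.
all: have := cardsD1 a A; have := cardsD1 b (A :\ a).
all: rewrite aA !inE bA eq_sym ab /= => c1 c2.
  by move: cA; rewrite c2 c1.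
right; exists (pair_probe a b) => k; have [|confY] := abP k; first by left.
by apply: IH confY _; lia.
Qed.

End TwoCops.

(** * One cop cannot win *)

Section OneCop.
Variable T : sgraph.
Hypothesis T_tree : is_tree T.
Variable f : T33 -> T.
Hypothesis f_inj : injective f.
Hypothesis f_adj : forall v w : T33, adj v w -> adj (f v) (f w).

Let i0 := @Ordinal 3 0 isT.
Let i1 := @Ordinal 3 1 isT.
Let i2 := @Ordinal 3 2 isT.

Definition T33_root : T := f None.
Definition T33_child (i : 'I_3) : T := f (Some (i, None)).
Definition T33_leaf (i : 'I_3) (j : 'I_2) : T := f (Some (i, Some j)).

Lemma adj_root_child i : adj T33_root (T33_child i).
Proof. exact: f_adj. Qed.

Lemma adj_child_leaf i j : adj (T33_child i) (T33_leaf i j).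
Proof. by apply: f_adj; rewrite /= /T33_adj /= eqxx. Qed.

Lemma T33_child_inj : injective T33_child.
Proof. by move=> i j /f_inj[]. Qed.

Lemma T33_leaf_inj i : injective (T33_leaf i).
Proof. by move=> j k /f_inj[]. Qed.

Lemma root_neq_leaf i j : T33_root != T33_leaf i j.
Proof. by apply/eqP => /f_inj. Qed.

Lemma two_far_neighbours c z (y : 'I_3 -> T) : injective y -> (forall i, adj z (y i)) ->
  exists i j, i != j /\ dist c (y i) = dist c (y j).
Proof.
move=> y_inj zy.
have far i j : i != j -> dist c (y i) <= dist c z -> dist c (y j) = (dist c z).+1.
  by move=> ij; apply: farther_of_closer => //; rewrite inj_eq.
have [i le|lt] := pickP (fun i => dist c (y i) <= dist c z).
  have [j [k [ij ik jk]]] : exists j k : 'I_3, [/\ i != j, i != k & j != k].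
    by case: i le => [[|[|[]]]] // ? _; [exists i1, i2|exists i0, i2|exists i0, i1].
  by exists j, k; split=> //; rewrite (far i j) // (far i k).
have {}lt i : dist c (y i) = (dist c z).+1.
  by apply/eqP; rewrite eqn_leq dist_edge // ltnNge lt.
by exists i0, i1; rewrite !lt.
Qed.

Definition undecided (X : {set T}) : Prop :=
  (exists i j, i != j /\ X = [set T33_child i; T33_child j]) \/
  (exists i j, X = [set T33_root; T33_leaf i j]).

Lemma undecided_gt1 X : undecided X -> 1 < #|X|.
Proof.
case=> [[i [j [ij ->]]]|[i [j ->]]]; rewrite cards2.
  by rewrite (inj_eq T33_child_inj) ij.
by rewrite root_neq_leaf.
Qed.

Lemma undecided_step X c : undecided X -> exists Y, undecided Y /\
  Y \subset closed_nbhd X /\ {in Y &, forall y z, dist c y = dist c z}.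
Proof.
have sub (A : {set T}) y z x1 x2 : x1 \in A -> x2 \in A -> (y == x1) || adj x1 y ->
   (z == x2) || adj x2 z -> [set y; z] \subset closed_nbhd A.
  move=> x1A x2A xy xz; apply/subsetP => w; rewrite !inE => /orP[]/eqP ->; apply/existsP.
    by exists x1; rewrite x1A.
  by exists x2; rewrite x2A.
have eq2 (y z : T) : dist c y = dist c z ->
    {in [set y; z] &, forall x w, dist c x = dist c w}.
  by move=> yz x w; rewrite !inE => /orP[]/eqP-> /orP[]/eqP->.
case=> [[i [j [ij ->]]]|[i [j ->]]]; last first.
  have [a [b [ab dab]]] := two_far_neighbours c T33_child_inj adj_root_child.
  exists [set T33_child a; T33_child b]; split; first by left; exists a, b.
  split; last exact: eq2.
  by apply: (sub _ _ _ T33_root T33_root); rewrite ?inE ?eqxx ?adj_root_child ?orbT.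
have [E|ne] := eqVneq (dist c (T33_child i)) (dist c (T33_child j)).
  exists [set T33_child i; T33_child j]; split; first by left; exists i, j.
  split; last exact: eq2.
  by apply: (sub _ _ _ (T33_child i) (T33_child j)); rewrite ?inE ?eqxx ?orbT.
(* Children at different distances from [c] cannot both be farther than the root. The robber then
   uses the closer child [k], from which the root and some leaf of the copy are both one step
   farther from [c]. *)
have [k [kij le]] : exists k, k \in [:: i; j] /\ dist c (T33_child k) <= dist c T33_root.
  have [le|lt] := leqP (dist c (T33_child i)) (dist c T33_root).
    by exists i; rewrite inE eqxx.
  exists j; split; first by rewrite !inE eqxx orbT.
  rewrite leqNgt; apply: contra ne => lt'; apply/eqP.
  have := dist_edge T_tree c (adj_root_child i); have := dist_edge T_tree c (adj_root_child j).
  lia.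
have rE : dist c T33_root = (dist c (T33_child k)).+1.
  have := dist_edge_neq T_tree c (adj_root_child k).
  have : adj (T33_child k) T33_root by rewrite adj_sym adj_root_child.
  move/(dist_edge T_tree c); lia.
have [l lE] : exists l, dist c (T33_leaf k l) = (dist c (T33_child k)).+1.
  have [le0|lt] := leqP (dist c (T33_leaf k ord0)) (dist c (T33_child k)).
    exists ord_max; apply: farther_of_closer le0; rewrite ?adj_child_leaf //.
    by rewrite (inj_eq (@T33_leaf_inj k)).
  exists ord0; apply/eqP; rewrite eqn_leq lt andbT.
  by rewrite dist_edge ?adj_child_leaf.
exists [set T33_root; T33_leaf k l]; split; first by right; exists k, l.
split; last by apply: eq2; rewrite rE lE.
have kX : T33_child k \in [set T33_child i; T33_child j].
  by move: kij; rewrite !inE => /orP[]/eqP->; rewrite eqxx ?orbT.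
apply: (sub _ _ _ (T33_child k) (T33_child k)) => //.
  by rewrite adj_sym adj_root_child orbT.
by rewrite adj_child_leaf orbT.
Qed.

Lemma localization_number_gt1 : 1 < localization_number T.
Proof.
rewrite ltnNge; apply/negP => k1; move: (localization_numberP T) k1.
move: (localization_number T) => k win k1; move: win.
apply: (@evasion _ _ undecided [set T33_child i0; T33_child i1]).
- by left; exists i0, i1.
- exact: undecided_gt1.
move=> X c FX.
(* The default covers [k = 0], where all answers are the empty tuple. *)
have [Y [FY [YX Yc]]] := undecided_step (head T33_root c) FX.
have /card_gt1P[y0 [_ [y0Y _ _]]] := undecided_gt1 FY.
exists (probe_answer c y0), Y; split=> //; apply/subsetP => y yY.
rewrite inE (subsetP YX) //=; apply/eqP/val_inj => /=.
case: c Yc => [[|v [|v' s]] sc] //= Yc; first by rewrite (Yc y y0).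
by move: k1; rewrite -(eqP sc).
Qed.

End OneCop.

(** * The first probe and the leaf count *)

Section FirstProbe.
Variable T : sgraph.
Hypothesis T_tree : is_tree T.
Variable f : T33 -> T.
Hypothesis f_inj : injective f.
Hypothesis f_adj : forall v w : T33, adj v w -> adj (f v) (f w).

Let u := T33_root f.
Local Notation depth := (dist u).
Local Notation meet := (meet u).

Lemma depth_child i : depth (T33_child f i) = 1.
Proof.
have ua := adj_root_child f_adj i.
have := dist_edge_neq T_tree u ua; have := dist_adj_le ua.
by rewrite -/u distxx; lia.
Qed.

Lemma depth_leaf i j : depth (T33_leaf f i j) = 2.
Proof.
rewrite -(depth_child i); apply: (@farther_of_closer _ T_tree u _ u).
- by rewrite adj_sym adj_root_child.
- exact: adj_child_leaf.
- exact: root_neq_leaf.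
- by rewrite distxx.
Qed.

(** [L i j] is a leaf of the tree below the corresponding leaf of the copy. Its ancestors at depths
    1 and 2 determine [i] and [j]. *)
Lemma exists_branch_leaves : exists L : 'I_3 -> 'I_2 -> T,
  [/\ forall i j, L i j \in leaves T,
      forall i j k l, (0 < meet (L i j) (L k l)) = (i == k) &
      forall i j k l, L i j = L k l -> i = k /\ j = l].
Proof.
have /choice[L0 L0P] : forall ij : 'I_3 * 'I_2, exists l,
    l \in leaves T /\ meet (T33_leaf f ij.1 ij.2) l = 2.
  move=> [i j]; have [|l lT] := @exists_leaf_below _ T_tree u (T33_leaf f i j).
    by rewrite eq_sym root_neq_leaf.
  by rewrite depth_leaf; exists l.
pose L i j := L0 (i, j).
have LT i j : L i j \in leaves T by case: (L0P (i, j)).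
have Lm i j : meet (T33_leaf f i j) (L i j) = 2 by case: (L0P (i, j)).
have Lc i j : 0 < meet (T33_child f i) (L i j).
  apply: (meet_trans T_tree (y := T33_leaf f i j)); last by rewrite Lm.
  by rewrite (meet_adj T_tree u (adj_child_leaf f_adj i j)) depth_child depth_leaf.
have mL i j k l : (0 < meet (L i j) (L k l)) = (i == k).
  apply/idP/eqP => [lt|->]; last first.
    by apply: (meet_trans T_tree (y := T33_child f k)); rewrite // meetC.
  apply: (T33_child_inj f_inj); apply: (meet_inj T_tree (u := u)); rewrite !depth_child //.
  apply: (meet_trans T_tree (Lc i j)); apply: (meet_trans T_tree lt).
  by rewrite meetC.
exists L; split=> // i j k l E.
have ik : i = k by apply/eqP; rewrite -(mL i j k l) E mL.
split=> //; rewrite -ik in E; apply: (@T33_leaf_inj _ f f_inj i).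
apply: (meet_inj T_tree (u := u)); rewrite !depth_leaf //.
by apply: (meet_trans T_tree (y := L i j)); [rewrite Lm | rewrite E meetC Lm].
Qed.

Lemma two_cops_win : cops_win_within T 2 (#|leaves T| %/ 2 - 1).
Proof.
have [L [LT mL L_inj]] := exists_branch_leaves.
pose i0 := @Ordinal 3 0 isT; pose i1 := @Ordinal 3 1 isT; pose i2 := @Ordinal 3 2 isT.
pose j0 := @Ordinal 2 0 isT; pose j1 := @Ordinal 2 1 isT.
pose a := L i0 j0; pose b := L i1 j0.
(* The path from [a] to [b] branches at the root, so every vertex satisfies the hypothesis of
   [confined_after_probe]. *)
have ab0 : meet a b = 0 by apply/eqP; rewrite -leqn0 leqNgt mL.
have L_neq i j k l : ((i, j) != (k, l)) -> L i j != L k l.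
  by apply: contraNneq => /L_inj[-> ->].
have drop4 (A : {set T}) c d : A \subset leaves T -> a \notin A -> b \notin A ->
    c \notin A -> d \notin A -> c \in leaves T -> d \in leaves T -> uniq [:: a; b; c; d] ->
    #|A| + 4 <= #|leaves T|.
  move=> /subsetP AT aA bA cA dA cT dT un.
  have {}un : uniq (enum A ++ [:: a; b; c; d]).
    by rewrite cat_uniq enum_uniq un /= !mem_enum !negb_or aA bA cA dA.
  rewrite !cardE -[4]/(size [:: a; b; c; d]) -size_cat; apply: uniq_leq_size un _ => x.
  rewrite mem_cat !mem_enum !inE => /orP[/AT|]; first by rewrite inE.
  by case/or4P => /eqP ->; move: (LT i0 j0) (LT i1 j0) cT dT; rewrite !inE.
(* This makes the bound positive, so that a first probe is available. *)
have l4 : 4 <= #|leaves T|.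
  suff : #|set0 : {set T}| + 4 <= #|leaves T| by rewrite cards0.
  apply: (drop4 _ (L i0 j1) (L i1 j1)).
  1-7: by rewrite ?sub0set ?in_set0 ?LT.
  by rewrite /= !(inE, negb_or) !L_neq.
have [g gE] : exists g, #|leaves T| %/ 2 - 1 = g.+1.
  by exists (#|leaves T| %/ 2 - 2); lia.
rewrite gE; apply: wins_from_within; exists (pair_probe a b) => k.
have [z _|le1|] := @confined_after_probe _ T_tree u setT a b k.
- by rewrite ab0.
- by left.
set Y := consistent _ _ _ => -[e [_ eY [conf _]]].
set A := [set l in _ | _] in conf.
apply: (confined_wins T_tree conf).
have AT : A \subset leaves T by apply/subsetP => l; rewrite inE => /andP[].
have memA l : l \in A -> exists2 y, y \in Y & e < meet y l.
  by rewrite inE => /andP[_ /existsP[y /andP[]]]; exists y.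
have aA : a \notin A by apply/negP => /memA[y /eY]; lia.
have bA : b \notin A by apply/negP => /memA[y /eY]; lia.
have pos y x z : 0 < meet y x -> 0 < meet y z -> 0 < meet x z.
  by rewrite (meetC u y x); apply: meet_trans.
(* Here [g] is half the number of leaves, rounded down, minus 2; the slack in [g.*2.+1] absorbs an
   odd number of leaves. *)
suff : #|A| + 4 <= #|leaves T| by lia.
(* If the projection is the root, no candidate lies in the branches of [a] and [b], whose other
   chosen leaves are discarded. Otherwise all candidates lie in one of these two branches, and the
   third branch is discarded. *)
have [e0|e_gt0] := posnP e.
  apply: (drop4 A (L i0 j1) (L i1 j1)); rewrite ?LT //.
  - apply/negP => /memA[y yY lt]; suff : 0 < meet y a by have := eY y yY; lia.
    by rewrite meetC; apply: (@meet_trans _ T_tree u _ a (L i0 j1)); [rewrite mL|rewrite meetC; lia].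
  - apply/negP => /memA[y yY lt]; suff : 0 < meet y b by have := eY y yY; lia.
    by rewrite meetC; apply: (@meet_trans _ T_tree u _ b (L i1 j1)); [rewrite mL|rewrite meetC; lia].
  - by rewrite /= !(inE, negb_or) !L_neq.
have notA j : L i2 j \notin A.
  apply/negP => /memA[y yY lt]; have := eY y yY => eE.
  have /orP[ya|yb] : (0 < meet y a) || (0 < meet y b) by lia.
    by have := pos y _ _ ya (leq_ltn_trans (leq0n _) lt); rewrite mL.
  by have := pos y _ _ yb (leq_ltn_trans (leq0n _) lt); rewrite mL.
apply: (drop4 A (L i2 j0) (L i2 j1)); rewrite ?LT ?notA //.
by rewrite /= !(inE, negb_or) !L_neq.
Qed.

End FirstProbe.

Theorem theorem2p3 (T : sgraph) (T_tree : is_tree T)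
    (T_T33 : contains_copy T T33) :
  lcapt T <= #|leaves T| %/ 2 - 1.
Proof.
have [f f_inj f_adj] := T_T33.
have two := two_cops_win T_tree f_inj f_adj.
have zE : localization_number T = 2.
  apply/eqP; rewrite eqn_leq (localization_number_gt1 T_tree f_inj f_adj) andbT.
  rewrite /localization_number; case: ex_minnP => k _; apply; apply/asboolP.
  have [s sw] := two; exists s => r /sw[t _ loc]; by exists t.
(* The proof that the cops win has a type mentioning the localization number, so it is generalized
   before that number becomes 2. *)
rewrite /lcapt; move: (localization_numberP T); rewrite zE => win.
rewrite /lcapt_with; case: ex_minnP => m _; apply; exact/asboolP.
Qed.
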